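(* In the setting of the context (decay function $\phi(t)=e^{-\rho t}$, $\rho>0$, and burst separation $t_{j+1}-t_j\ge 4\beta$), with $M\ge 1$ and $a\in\mathbb R$ such that $\|T(t)\|\le Me^{at}$ for all $t\ge 0$, let $$Q(g,\beta)=e^{(\rho+a)\beta}ML\|g\|\beta+e^{a\beta}(e^{\rho\beta}-1)MK\|g\|+4e^{\rho\beta}\sigma ,\qquad g\in\widetilde G,$$ be the threshold in Algorithm 1 (described in the context). Let also $\mathfrak t_j$ and $\mathfrak f_j(g)$ be the outputs of Algorithm 1 for the $j$-th burst (with $\mathfrak f_j(g)=0$ if the $j$-th burst is not detected). Then $|\mathfrak t_j-t_j|\le\beta$ and $$|\mathfrak f_j(g)-\langle h_j,g\rangle|\le 3e^{(3\rho+a)\beta}ML\|g\|\beta+e^{a\beta}(e^{3\rho\beta}-1)MK\|g\|+4e^{3\rho\beta}\sigma+2e^{\rho\beta}Q(g,\beta)+\max\{v_0(h_j,g,\beta),v_1(h_j,g,\beta)\},$$ where $v_0,v_1$ are the quantities defined in the context. In particular, for sufficiently small $\beta>0$, one has $|\mathfrak f_j(g)-\langle h_j,g\rangle|\le 13\sigma$ as long as $\sigma>0$.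
   Context: Setting. $\mathcal H$ is a Hilbert space of functions on a subset of $\mathbb R^d$, $A:D(A)\subseteq\mathcal H\to\mathcal H$ generates a strongly continuous semigroup $T:[0,\infty)\to B(\mathcal H)$, and $u_0\in\mathcal H$. Let $\rho>0$, $0<t_1<\dots<t_N$ (burst times) and $h_1,\dots,h_N\in\mathcal H$ (burst shapes). The state $u$ is the mild solution of $$\dot u(t)=Au(t)+\sum_{j=1}^N h_je^{-\rho(t-t_j)}\chi_{[t_j,\infty)}(t)+\eta(t),\qquad u(0)=u_0,$$ that is, $u(t)=T(t)u_0+\int_0^tT(t-s)F(s)\,ds$ with $F(s)=\sum_{j=1}^N h_je^{-\rho(s-t_j)}\chi_{[t_j,\infty)}(s)+\eta(s)$. Assumptions. $\beta>0$ is the time sampling step. The set of samplers is $G=\widetilde G\cup T^*(\beta)\widetilde G$ for a countable (possibly finite) set $\widetilde G\subseteq\mathcal H$. The background source $\eta:[0,\infty)\to\mathcal H$ satisfies $\sup_{t\ge0}\|\eta(t)\|\le K$ and $\|\eta(t+s)-\eta(t)\|\le Ls$ for all $s,t\ge0$, where $K>0$, $L\ge0$. The bursts satisfy $t_{j+1}-t_j\ge4\beta$. The measurements are given by a real-valued function $\mathfrak m(t,f)=\langle u(t),f\rangle+\nu(t,f)$, where the additive noise $\nu$ satisfies $\sup_{t>0,\,f\in\mathcal H}|\nu(t,f)|\le\sigma$. Measurements. Write $\mathfrak m_n(f)=\mathfrak m(n\beta,f)$. For $g\in\widetilde G$ one acquires $\mathfrak m_n(\tfrac g\beta)$ and $\mathfrak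 m_n(\tfrac{T^*(\beta)g}{\beta})$ and puts $$F_n=\mathfrak m_{n+1}\big(\tfrac g\beta\big)-\mathfrak m_n\big(\tfrac{T^*(\beta)g}{\beta}\big),\qquad \Delta_n=e^{\rho\beta}F_{n+1}-F_n .$$ Algorithm 1 (with threshold $Q(g,\beta)$ and time horizon $T_{\max}$). For each $g\in\widetilde G$: start with $i=1$. While $i\beta<T_{\max}$: if $|\Delta_i|>Q(g,\beta)$, output $\mathfrak f(g)=e^{3\rho\beta}F_{i+2}-F_{i-1}$ and $\mathfrak t=(i+1)\beta$, and replace $i$ by $i+3$; otherwise, if $|\Delta_{i+1}|>Q(g,\beta)$, output $\mathfrak f(g)=e^{3\rho\beta}F_{i+3}-F_i$ and $\mathfrak t=(i+2)\beta$, and replace $i$ by $i+3$; otherwise replace $i$ by $i+1$. When the $j$-th burst lies in $[(n+1)\beta,(n+2)\beta)$, it is detected if and only if $|\Delta_n|>Q(g,\beta)$ or $|\Delta_{n+1}|>Q(g,\beta)$. Notation. For $k=0,1$, with $n$ the integer such that $t_j\in[(n+1)\beta,(n+2)\beta)$, $$v_k(h_j,g,\beta)=\left|\int_0^\beta\Big\langle T(\beta-s)h_je^{\rho(t_j-(n-k)\beta-s)},\frac g\beta\Big\rangle ds-\langle h_j,g\rangle\right| ,$$ which satisfies $$v_k(h_j,g,\beta)\le\|g\|\Big(M\|h_j\|(e^{(k+2)\rho\beta}-1)\mathbf e(a\beta)+\sup_{s\in[0,\beta]}\|T(s)h_j-h_j\|\Big),$$ where $\mathbf e(t)=\frac{e^t-1}{t}$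 for $t\ne0$ and $\mathbf e(0)=1$.
   Formalization: For general β the formal theorem assumes a ≥ 0 and 2β ≤ t_j for all bursts (the claim can fail otherwise); for small β any real a is allowed. Throughout, t_j < T_max, the noise bound also holds at t = 0, and the time bound concerns detected bursts only. *)

(* Defs.v *)
From Stdlib Require Import Reals List Lra.
From Coquelicot Require Import Coquelicot.

Open Scope R_scope.

(** A real Hilbert space is a [CompleteNormedModule R_AbsRing] whose norm is
    induced by an inner product. *)
Record is_inner_product {H : CompleteNormedModule R_AbsRing}
    (ip : H -> H -> R) : Prop := {
  ip_sym : forall x y, ip x y = ip y x;
  ip_plus_l : forall x y z, ip (plus x y) z = ip x z + ip y z;
  ip_scal_l : forall (c : R) x y, ip (scal c x) y = c * ip x y;
  ip_norm : forall x, ip x x = norm x ^ 2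
}.

(** Semigroups are total functions on [R]; only their values at times [t >= 0]
    are constrained, and the same holds for every other function of time. *)
Record is_C0_semigroup {H : CompleteNormedModule R_AbsRing}
    (T : R -> H -> H) : Prop := {
  sg_linear : forall t, 0 <= t -> is_linear (T t);
  sg_zero : forall x, T 0 x = x;
  sg_plus : forall s t x, 0 <= s -> 0 <= t -> T (s + t) x = T s (T t x);
  sg_strong : forall x, filterlim (fun t => T t x) (at_right 0) (locally x)
}.

Definition is_right_derivative_at_0 {H : CompleteNormedModule R_AbsRing}
    (T : R -> H -> H) (x y : H) : Prop :=
  filterlim (fun t : R => scal (/ t) (minus (T t x) x))
    (at_right 0) (locally y).

Definition generates {H : CompleteNormedModule R_AbsRing}
    (D : H -> Prop) (A : H -> H) (T : R -> H -> H) : Prop :=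
  (forall x, D x <-> exists y, is_right_derivative_at_0 T x y) /\
  (forall x, D x -> is_right_derivative_at_0 T x (A x)).

Definition is_adjoint {H : CompleteNormedModule R_AbsRing}
    (ip : H -> H -> R) (B B' : H -> H) : Prop :=
  forall x y, ip (B x) y = ip x (B' y).

Definition countable_set {X : Type} (S : X -> Prop) : Prop :=
  exists e : nat -> X, forall x, S x -> exists k, e k = x.

Definition step_at (t0 s : R) : R := if Rle_dec t0 s then 1 else 0.

(** Bursts are indexed by [1, ..., N]. *)
Definition source {H : CompleteNormedModule R_AbsRing} (rho : R) (N : nat)
    (t : nat -> R) (h : nat -> H) (eta : R -> H) (s : R) : H :=
  plus
    (sum_n_m (fun j => scal (exp (- rho * (s - t j)) * step_at (t j) s) (h j))
       1 N)
    (eta s).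

(** The integral is the Riemann integral in [H]; for a piecewise continuous
    source it exists and agrees with the Bochner integral. *)
Definition is_mild_solution {H : CompleteNormedModule R_AbsRing}
    (T : R -> H -> H) (u0 : H) (src u : R -> H) : Prop :=
  forall t, 0 <= t ->
    is_RInt (fun s => T (t - s) (src s)) 0 t (minus (u t) (T t u0)).

Definition burst_times (N : nat) (t : nat -> R) : Prop :=
  (forall j, (1 <= j <= N)%nat -> 0 < t j) /\
  (forall j, (1 <= j < N)%nat -> t j < t (S j)).

Definition F_meas {H : CompleteNormedModule R_AbsRing} (Tadj : R -> H -> H)
    (m : R -> H -> R) (beta : R) (g : H) (n : nat) : R :=
  m (INR (S n) * beta) (scal (/ beta) g)
  - m (INR n * beta) (scal (/ beta) (Tadj beta g)).

Definition Delta (rho beta : R) (F : nat -> R) (n : nat) : R :=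
  exp (rho * beta) * F (S n) - F n.

(** The factor [exp (a * beta)] dominates [exp (a * s)] on [[0, beta]] only when
    [0 <= a]. For [a < 0] and an arbitrary step [beta] the threshold can lie
    below the response to the background source alone. *)
Definition threshold (rho a M L K sigma beta normg : R) : R :=
  exp ((rho + a) * beta) * M * L * normg * beta
  + exp (a * beta) * (exp (rho * beta) - 1) * M * K * normg
  + 4 * exp (rho * beta) * sigma.

(** Big-step semantics of the while loop of the algorithm: entered with counter
    [i], it terminates after emitting the given pairs (shape, time), in that
    order. The four guards are exclusive, so the loop is deterministic. *)
Inductive algorithm_loop (rho beta Q Tmax : R) (F : nat -> R) :
    nat -> list (R * R) -> Prop :=
| loop_exit i :
    Tmax <= INR i * beta ->
    algorithm_loop rho beta Q Tmax F i nil
| loop_detect i out :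
    INR i * beta < Tmax ->
    Q < Rabs (Delta rho beta F i) ->
    algorithm_loop rho beta Q Tmax F (i + 3) out ->
    algorithm_loop rho beta Q Tmax F i
      ((exp (3 * rho * beta) * F (i + 2)%nat - F (i - 1)%nat,
        INR (i + 1) * beta) :: out)
| loop_detect_next i out :
    INR i * beta < Tmax ->
    Rabs (Delta rho beta F i) <= Q ->
    Q < Rabs (Delta rho beta F (i + 1)) ->
    algorithm_loop rho beta Q Tmax F (i + 3) out ->
    algorithm_loop rho beta Q Tmax F i
      ((exp (3 * rho * beta) * F (i + 3)%nat - F i,
        INR (i + 2) * beta) :: out)
| loop_skip i out :
    INR i * beta < Tmax ->
    Rabs (Delta rho beta F i) <= Q ->
    Rabs (Delta rho beta F (i + 1)) <= Q ->
    algorithm_loop rho beta Q Tmax F (i + 1) out ->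
    algorithm_loop rho beta Q Tmax F i out.

(** For [beta <= t], the [n] such that [(n+1) beta <= t < (n+2) beta]. *)
Definition slot (beta t : R) : nat := (Z.to_nat (Int_part (t / beta)) - 1)%nat.

Definition detected (rho beta Q : R) (F : nat -> R) (tj : R) : bool :=
  let n := slot beta tj in
  if Rlt_dec Q (Rabs (Delta rho beta F n)) then true
  else if Rlt_dec Q (Rabs (Delta rho beta F (n + 1))) then true
  else false.

(** [ff j] and [tt j] are the outputs for the [j]-th burst: the list emitted by
    the algorithm enumerates [(ff j, tt j)] over the detected bursts in order of
    occurrence, and [ff j = 0] when the [j]-th burst is not detected (in which
    case [tt j] has no meaning). *)
Definition burst_outputs (rho beta Q Tmax : R) (F : nat -> R) (N : nat)
    (t tt ff : nat -> R) : Prop :=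
  algorithm_loop rho beta Q Tmax F 1
    (map (fun j => (ff j, tt j))
       (filter (fun j => detected rho beta Q F (t j)) (List.seq 1 N))) /\
  (forall j, (1 <= j <= N)%nat ->
     detected rho beta Q F (t j) = false -> ff j = 0).

Definition v {H : CompleteNormedModule R_AbsRing} (ip : H -> H -> R)
    (T : R -> H -> H) (rho beta : R) (k : nat) (tj : R) (hj g : H) : R :=
  Rabs
    (RInt (fun s =>
       ip (T (beta - s)
             (scal (exp (rho * (tj - (INR (slot beta tj) - INR k) * beta - s)))
                hj))
          (scal (/ beta) g)) 0 beta
     - ip hj g).

Definition shape_error_bound {H : CompleteNormedModule R_AbsRing}
    (ip : H -> H -> R) (T : R -> H -> H)
    (rho a M L K sigma beta Q tj : R) (hj g : H) : R :=
  3 * exp ((3 * rho + a) * beta) * M * L * norm g * beta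
  + exp (a * beta) * (exp (3 * rho * beta) - 1) * M * K * norm g
  + 4 * exp (3 * rho * beta) * sigma
  + 2 * exp (rho * beta) * Q
  + Rmax (v ip T rho beta 0 tj hj g) (v ip T rho beta 1 tj hj g).

(* Main.v *)
(** [F n] is, up to noise of size [2 sigma], the average over the [n]-th time
    step of the response [<T (beta - s) (src (n beta + s)), g>]. Between two
    steps at distance [p] a burst that is already active decays by exactly
    [exp (- p rho beta)], so in [exp (p rho beta) F (k + p) - F k] only the
    bursts starting in between survive, next to a background term controlled by
    [K] and [L] and the noise. Hence [|Delta k| <= Q] unless step [k] or [k + 1]
    contains the start of a burst, so the algorithm raises no false alarm; and
    for [p = 3] (or [p = 2] when the burst is missed, the difference then being
    a combination of two small [Delta]s) the surviving term is
    [<h_j, g>] up to [v_0] or [v_1]. For small [beta] the noise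
    [2 (1 + exp (p rho beta)) sigma] stays below the budget
    [4 exp (p rho beta) sigma] by a margin of order [beta], which also covers the
    case [a < 0]. *)
Require Import Defs.
From Stdlib Require Import Reals ZArith List Lra Lia Sorted.
From Coquelicot Require Import Coquelicot.

Open Scope R_scope.

(** * Riemann integrals and finite sums *)

Lemma Riemann_sum_linear {U V : NormedModule R_AbsRing} (l : U -> V)
  (f : R -> U) (ptd : SF_seq) :
  is_linear l -> Riemann_sum (fun x => l (f x)) ptd = l (Riemann_sum f ptd).
Proof.
  intros Hl. induction ptd as [x0 | h0 ptd IH] using SF_cons_ind.
  - unfold Riemann_sum; simpl. exact (eq_sym (linear_zero l Hl)).
  - rewrite !Riemann_sum_cons, IH, (linear_plus l Hl), (linear_scal l Hl).
    reflexivity.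
Qed.

Lemma is_RInt_linear {U V : NormedModule R_AbsRing} (l : U -> V)
  (f : R -> U) (a b : R) (I : U) :
  is_linear l -> is_RInt f a b I -> is_RInt (fun x => l (f x)) a b (l I).
Proof.
  intros Hl Hf. unfold is_RInt in *.
  apply filterlim_ext with
    (fun ptd => l (scal (sign (b - a)) (Riemann_sum f ptd))).
  { intros ptd. rewrite (Riemann_sum_linear l f ptd Hl). apply (linear_scal l Hl). }
  eapply filterlim_comp; [exact Hf | apply (linear_cont l I Hl)].
Qed.

(** The bound is asked on the open interval only: a burst may start exactly at a grid point, where
    the integrand jumps. Resetting [f] to 0 at the end points does not change the integral. *)
Lemma is_RInt_norm_le_open (f : R -> R) (b c I : R) :
  0 <= b -> 0 <= c -> (forall s, 0 < s < b -> Rabs (f s) <= c) ->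
  is_RInt f 0 b I -> Rabs I <= b * c.
Proof.
  intros Hb Hc Hf HI.
  pose (g := fun s => if Rlt_dec 0 s then if Rlt_dec s b then f s else 0 else 0).
  replace (b * c) with ((b - 0) * c) by ring.
  apply (norm_RInt_le_const (V := R_NormedModule) g 0 b I c Hb).
  - intros s _. unfold g. change (norm ?x) with (Rabs x).
    destruct (Rlt_dec 0 s); [destruct (Rlt_dec s b)|];
      try (rewrite Rabs_R0; lra). now apply Hf.
  - apply is_RInt_ext with f; trivial.
    rewrite Rmin_left, Rmax_right by lra. intros s [h1 h2]. unfold g.
    destruct (Rlt_dec 0 s); [destruct (Rlt_dec s b)|]; lra.
Qed.

Lemma is_RInt_shift (f : R -> R) (c b I : R) :
  is_RInt f c (c + b) I -> is_RInt (fun s => f (c + s)) 0 b I.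
Proof.
  intros Hf. apply is_RInt_ext with (fun y => scal 1 (f (1 * y + c))).
  { intros x _. change (1 * f (1 * x + c) = f (c + x)).
    rewrite !Rmult_1_l. f_equal. ring. }
  apply (is_RInt_comp_lin f 1 c 0 b I).
  now replace (1 * 0 + c) with c by ring; replace (1 * b + c) with (c + b) by ring.
Qed.

Lemma sum_n_m_single {G : AbelianMonoid} (w : nat -> G) (j N : nat) :
  (1 <= j <= N)%nat -> (forall i, (1 <= i <= N)%nat -> i <> j -> w i = zero) ->
  sum_n_m w 1 N = w j.
Proof.
  intros Hj Hw.
  rewrite (sum_n_m_Chasles w 1 j N) by lia.
  rewrite (sum_n_m_ext_loc w (fun _ => zero) (S j) N)
    by (intros i Hi; apply Hw; lia).
  rewrite sum_n_m_const_zero, plus_zero_r.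
  destruct j as [|j]; [lia|].
  rewrite (sum_n_Sm w 1 j) by lia.
  rewrite (sum_n_m_ext_loc w (fun _ => zero) 1 j)
    by (intros i Hi; apply Hw; lia).
  now rewrite sum_n_m_const_zero, plus_zero_l.
Qed.

(** * Norms and inner products *)

(** The axioms of a normed module give [<=]; applying that inequality to [/ c] and [scal c x] gives
    the converse. *)
Lemma norm_scal_Rabs {V : NormedModule R_AbsRing} (c : R) (x : V) :
  norm (scal c x) = Rabs c * norm x.
Proof.
  apply Rle_antisym; [apply (norm_scal c x)|].
  destruct (Req_dec c 0) as [-> | Hc].
  { rewrite Rabs_R0, Rmult_0_l. apply norm_ge_0. }
  apply Rmult_le_reg_l with (Rabs (/ c)).
  { apply Rabs_pos_lt. now apply Rinv_neq_0_compat. }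
  rewrite <- Rmult_assoc, <- Rabs_mult, Rinv_l, Rabs_R1, Rmult_1_l by trivial.
  eapply Rle_trans; [|apply (norm_scal (/ c))].
  rewrite scal_assoc. change (mult (/ c) c) with (/ c * c).
  rewrite Rinv_l by trivial. change 1 with (@one R_AbsRing).
  rewrite (scal_one x). apply Rle_refl.
Qed.

(** The quadratic polynomial [r -> norm (plus x (scal r y)) ^ 2] is nonnegative; a suitable [r]
    turns this into the inequality. *)
Lemma Cauchy_Schwarz {H : CompleteNormedModule R_AbsRing} (ip : H -> H -> R)
  (Hip : is_inner_product ip) (x y : H) : Rabs (ip x y) <= norm x * norm y.
Proof.
  assert (Hq : forall r : R,
    0 <= norm x ^ 2 + 2 * r * ip x y + r ^ 2 * norm y ^ 2).
  { intros r.
    replace (_ + _) with (norm (plus x (scal r y)) ^ 2)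
      by (rewrite <- !(ip_norm _ Hip), (ip_plus_l _ Hip), (ip_scal_l _ Hip),
            (ip_sym _ Hip x (plus _ _)), (ip_sym _ Hip y (plus _ _)),
            !(ip_plus_l _ Hip), !(ip_scal_l _ Hip), (ip_sym _ Hip y x); ring).
    apply pow2_ge_0. }
  pose proof (norm_ge_0 x) as Hx. pose proof (norm_ge_0 y) as Hy.
  assert (Hs : (ip x y) ^ 2 <= (norm x * norm y) ^ 2).
  { destruct (Req_dec (norm y) 0) as [E | E].
    - rewrite E in *.
      destruct (Req_dec (ip x y) 0) as [-> | E']; [nra|].
      (* With [norm y = 0] the polynomial is affine in [r]; at this [r] it would equal -1. *)
      specialize (Hq (- (norm x ^ 2 + 1) / (2 * ip x y))).
      replace (2 * (- (norm x ^ 2 + 1) / (2 * ip x y)) * ip x y)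
        with (- (norm x ^ 2 + 1)) in Hq by (field; trivial).
      nra.
    (* The minimiser of the polynomial. *)
    - specialize (Hq (- ip x y / norm y ^ 2)).
      apply Rmult_le_compat_l with (r := norm y ^ 2) in Hq; [|nra].
      rewrite Rmult_0_r in Hq.
      replace (norm y ^ 2 * _) with ((norm x * norm y) ^ 2 - ip x y ^ 2) in Hq
        by (field; trivial).
      lra. }
  apply Rsqr_incr_0_var; [|nra]. rewrite <- Rsqr_abs, !Rsqr_pow2. exact Hs.
Qed.

Lemma ip_linear_l {H : CompleteNormedModule R_AbsRing} (ip : H -> H -> R)
  (Hip : is_inner_product ip) (y : H) :
  is_linear (fun x => ip x y : R_NormedModule).
Proof.
  constructor.
  - intros x z. apply (ip_plus_l _ Hip).
  - intros c x. apply (ip_scal_l _ Hip).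
  - exists (norm y + 1). pose proof (norm_ge_0 y). split; [lra|]. intros x.
    eapply Rle_trans; [apply (Cauchy_Schwarz ip Hip)|].
    pose proof (norm_ge_0 x). nra.
Qed.

Lemma ip_T_linear {H : CompleteNormedModule R_AbsRing} (ip : H -> H -> R)
  (Hip : is_inner_product ip) (T : R -> H -> H) (HT : is_C0_semigroup T)
  (s : R) (y : H) :
  0 <= s -> is_linear (fun x => ip (T s x) y : R_NormedModule).
Proof.
  intros Hs. apply (is_linear_comp (T s) (fun x => ip x y : R_NormedModule)).
  - now apply (sg_linear _ HT).
  - now apply ip_linear_l.
Qed.

Lemma exp_monotone (x y : R) : x <= y -> exp x <= exp y.
Proof.
  intros [Hlt | ->]; [left; now apply exp_increasing | apply Rle_refl].
Qed.

(** * Strongly continuous semigroups *)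

Lemma semigroup_right_continuous {H : CompleteNormedModule R_AbsRing}
  (T : R -> H -> H) (HT : is_C0_semigroup T) (x : H) (eps : R) :
  0 < eps ->
  exists d, 0 < d /\ forall r, 0 <= r < d -> norm (minus (T r x) x) < eps.
Proof.
  intros Heps.
  pose proof (sg_strong _ HT x) as HS.
  rewrite (filterlim_locally_ball_norm (F := at_right 0)
             (fun r : R => T r x) x) in HS.
  destruct (HS (mkposreal eps Heps)) as [d Hd].
  exists d. split; [apply cond_pos|]. intros r Hr.
  (* The filter [at_right 0] says nothing about time 0 itself; there [T 0 x = x]. *)
  destruct (Req_dec r 0) as [-> | Hr0].
  - rewrite (sg_zero _ HT), minus_eq_zero.
    apply Rle_lt_trans with 0; [right; exact (@norm_zero R_AbsRing H) | exact Heps].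
  - apply (Hd r); [|lra].
    change (Rabs (r - 0) < d). rewrite Rabs_pos_eq; lra.
Qed.

(** Factoring [T q = T p T (q - p)] reduces an increment at any time to one at time 0, so continuity
    at 0 spreads to the whole orbit. *)
Lemma semigroup_increment {H : CompleteNormedModule R_AbsRing}
  (T : R -> H -> H) (HT : is_C0_semigroup T) (M a : R)
  (HMa : forall s x, 0 <= s -> norm (T s x) <= M * exp (a * s) * norm x)
  (x : H) (p q : R) :
  0 <= p <= q ->
  norm (minus (T q x) (T p x)) <=
    M * exp (a * p) * norm (minus (T (q - p) x) x).
Proof.
  intros Hpq. replace (T q x) with (T p (T (q - p) x)).
  - rewrite <- (linear_minus (T p)) by (apply (sg_linear _ HT); lra).
    apply HMa; lra.
  - rewrite <- (sg_plus _ HT) by lra. f_equal; ring.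
Qed.

(* [Rmax 0] extends the orbit to negative times, where [T] is arbitrary. *)
Lemma semigroup_orbit_continuous {H : CompleteNormedModule R_AbsRing}
  (T : R -> H -> H) (HT : is_C0_semigroup T) (M a : R) (HM : 1 <= M)
  (HMa : forall s x, 0 <= s -> norm (T s x) <= M * exp (a * s) * norm x)
  (x : H) (r : R) : continuous (fun s => T (Rmax 0 s) x) r.
Proof.
  unfold continuous.
  rewrite (filterlim_locally_ball_norm (F := locally r)
             (fun s : R => T (Rmax 0 s) x) (T (Rmax 0 r) x)).
  intros eps.
  (* Bounds the growth factor [M * exp (a * p)] for all [0 <= p <= Rabs r + 1], that is, uniformly
     near [r]. *)
  set (B := M * exp (Rabs a * (Rabs r + 1))).
  assert (HB : 0 < B) by (apply Rmult_lt_0_compat; [lra | apply exp_pos]).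
  destruct (semigroup_right_continuous T HT x (eps / B)) as [d [Hd Hx]].
  { apply Rdiv_lt_0_compat; [apply cond_pos | exact HB]. }
  assert (Hd1 : 0 < Rmin d 1) by (apply Rmin_pos; lra).
  exists (mkposreal _ Hd1). intros s Hs.
  change (Rabs (s - r) < Rmin d 1) in Hs.
  assert (Hsd : Rabs (s - r) < d /\ Rabs (s - r) < 1).
  { pose proof (Rmin_l d 1). pose proof (Rmin_r d 1). lra. }
  assert (Key : forall p q, 0 <= p <= q -> q - p < d -> p <= Rabs r + 1 ->
            norm (minus (T q x) (T p x)) < eps).
  { intros p q Hpq Hlt Hp.
    eapply Rle_lt_trans; [apply (semigroup_increment T HT M a HMa); lra|].
    assert (HMp : M * exp (a * p) <= B).
    { apply Rmult_le_compat_l; [lra|]. apply exp_monotone.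
      pose proof (Rle_abs a). pose proof (Rabs_pos a). nra. }
    pose proof (norm_ge_0 (minus (T (q - p) x) x)).
    apply Rle_lt_trans with (B * norm (minus (T (q - p) x) x)).
    { apply Rmult_le_compat_r; trivial. }
    replace (pos eps) with (B * (eps / B)) by (field; lra).
    apply Rmult_lt_compat_l; trivial. apply Hx; lra. }
  unfold ball_norm.
  assert (Hsd' := Rabs_def2 _ _ (proj1 Hsd)).
  assert (Hr : Rmax 0 r <= Rabs r)
    by (apply Rmax_lub; [apply Rabs_pos | apply Rle_abs]).
  destruct (Rle_dec (Rmax 0 r) (Rmax 0 s)) as [Hle | Hle].
  - apply Key; [pose proof (Rmax_l 0 r); lra | | lra].
    unfold Rmax in *; repeat destruct Rle_dec; lra.
  - rewrite <- norm_opp, opp_minus. apply Key.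
    + pose proof (Rmax_l 0 s); lra.
    + unfold Rmax in *; repeat destruct Rle_dec; lra.
    + lra.
Qed.

(** Ensures that the integral in [v] is a genuine one: with the scalar pulled out, the integrand is
    an exponential times a continuous orbit tested against [y]. *)
Lemma ex_RInt_burst_response {H : CompleteNormedModule R_AbsRing}
  (ip : H -> H -> R) (Hip : is_inner_product ip)
  (T : R -> H -> H) (HT : is_C0_semigroup T) (M a : R) (HM : 1 <= M)
  (HMa : forall s x, 0 <= s -> norm (T s x) <= M * exp (a * s) * norm x)
  (rho c beta : R) (x y : H) :
  0 <= beta ->
  ex_RInt (fun s => ip (T (beta - s) (scal (exp (rho * (c - s))) x)) y) 0 beta.
Proof.
  intros Hb.
  apply ex_RInt_ext with
    (fun s => exp (rho * (c - s)) * ip (T (Rmax 0 (beta - s)) x) y).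
  - rewrite Rmin_left, Rmax_right by lra. intros s Hs.
    rewrite Rmax_right by lra.
    rewrite (linear_scal (T (beta - s))) by (apply (sg_linear _ HT); lra).
    now rewrite (ip_scal_l _ Hip).
  - apply (ex_RInt_continuous (V := R_CompleteNormedModule)). intros s _.
    apply (continuous_mult (fun s => exp (rho * (c - s)))
             (fun s => ip (T (Rmax 0 (beta - s)) x) y)).
    + apply (ex_derive_continuous (fun s => exp (rho * (c - s)))).
      auto_derive; trivial.
    + apply (continuous_comp (fun s => T (Rmax 0 (beta - s)) x)
               (fun z => ip z y : R_NormedModule)).
      * apply (continuous_comp (fun s => beta - s) (fun s => T (Rmax 0 s) x)).
        -- apply (ex_derive_continuous (fun s => beta - s)).
           auto_derive; trivial.
        -- apply (semigroup_orbit_continuous T HT M a HM HMa).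
      * exact (linear_cont _ _ (ip_linear_l ip Hip y)).
Qed.

(** * Measurements *)

(** The adjoint moves [T beta] from the sampler to the state, so [F_meas] tests
    [u (p + beta) - T beta (u p)] against [scal (/ beta) g]. In this difference the initial value
    and the source before time [p] cancel. *)
Lemma is_RInt_response {H : CompleteNormedModule R_AbsRing}
  (ip : H -> H -> R) (Hip : is_inner_product ip)
  (T Tadj : R -> H -> H) (HT : is_C0_semigroup T)
  (HTadj : forall s, 0 <= s -> is_adjoint ip (T s) (Tadj s))
  (u0 : H) (src u : R -> H) (Hu : is_mild_solution T u0 src u)
  (beta : R) (Hb : 0 < beta) (g : H) (k : nat) :
  is_RInt (fun s => ip (T (beta - s) (src (INR k * beta + s))) (scal (/ beta) g))
    0 beta (F_meas Tadj (fun s f => ip (u s) f) beta g k).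
Proof.
  pose (y := scal (/ beta) g). pose (p := INR k * beta). fold y p.
  assert (Hp : 0 <= p)
    by (apply Rmult_le_pos; [apply pos_INR | lra]).
  assert (HF : F_meas Tadj (fun s f => ip (u s) f) beta g k =
    ip (minus (u (p + beta)) (T (p + beta) u0)) y
    - ip (T beta (minus (u p) (T p u0))) y).
  { unfold F_meas. fold y p.
    replace (INR (S k) * beta) with (p + beta)
      by (unfold p; rewrite S_INR; ring).
    rewrite (ip_sym _ Hip (u p)), (ip_scal_l _ Hip), (ip_sym _ Hip _ (u p)).
    rewrite <- (HTadj beta (Rlt_le _ _ Hb) (u p) g).
    assert (Ty : forall z, / beta * ip z g = ip z y)
      by (intros z; unfold y;
          now rewrite (ip_sym _ Hip z), <- (ip_scal_l _ Hip), (ip_sym _ Hip z)).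
    rewrite Ty.
    rewrite (linear_minus (T beta)) by (apply (sg_linear _ HT); lra).
    rewrite <- (sg_plus _ HT) by lra. rewrite (Rplus_comm beta p).
    rewrite !(linear_minus _ _ _ (ip_linear_l ip Hip y)).
    unfold minus, plus, opp; simpl. unfold plus, opp; simpl. ring. }
  rewrite HF.
  assert (H1 : is_RInt (fun s => ip (T (p + beta - s) (src s)) y) 0 (p + beta)
                 (ip (minus (u (p + beta)) (T (p + beta) u0)) y)).
  { apply (is_RInt_linear (fun z => ip z y : R_NormedModule)
             (fun s => T (p + beta - s) (src s))).
    - now apply ip_linear_l.
    - apply Hu; lra. }
  (* Propagating the mild solution formula at time [p] by [T beta] gives the integrand of [H1], over
     the shorter interval. *)
  assert (H2 : is_RInt (fun s => ip (T (p + beta - s) (src s)) y) 0 p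
                 (ip (T beta (minus (u p) (T p u0))) y)).
  { apply is_RInt_ext with (fun s => ip (T beta (T (p - s) (src s))) y).
    - rewrite Rmin_left, Rmax_right by lra. intros s Hs.
      rewrite <- (sg_plus _ HT) by lra.
      now replace (beta + (p - s)) with (p + beta - s) by ring.
    - apply (is_RInt_linear (fun z => ip (T beta z) y : R_NormedModule)
               (fun s => T (p - s) (src s))).
      + apply ip_T_linear; trivial; lra.
      + apply Hu; lra. }
  pose proof (is_RInt_Chasles _ _ _ _ _ _ (is_RInt_swap _ _ _ _ H2) H1) as H3.
  apply is_RInt_shift in H3.
  replace (_ - _) with
    (plus (opp (ip (T beta (minus (u p) (T p u0))) y))
       (ip (minus (u (p + beta)) (T (p + beta) u0)) y))
    by (unfold plus, opp; simpl; ring).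
  eapply is_RInt_ext; [|exact H3].
  intros s _. simpl. now replace (p + beta - (p + s)) with (beta - s) by ring.
Qed.

(** The noise bound is uniform in the sampler, so the factor [/ beta] in the samplers does not
    amplify it. *)
Lemma F_meas_noise {H : CompleteNormedModule R_AbsRing} (ip : H -> H -> R)
  (Tadj : R -> H -> H) (u : R -> H) (nu m : R -> H -> R) (sigma : R)
  (Hnu : forall s f, 0 <= s -> Rabs (nu s f) <= sigma)
  (Hm : forall s f, 0 <= s -> m s f = ip (u s) f + nu s f)
  (beta : R) (Hb : 0 < beta) (g : H) (k : nat) :
  Rabs (F_meas Tadj m beta g k - F_meas Tadj (fun s f => ip (u s) f) beta g k)
    <= 2 * sigma.
Proof.
  assert (Hk : forall i, 0 <= INR i * beta)
    by (intros i; apply Rmult_le_pos; [apply pos_INR | lra]).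
  unfold F_meas. rewrite !Hm by apply Hk.
  pose proof (Hnu _ (scal (/ beta) g) (Hk (S k))) as N1.
  pose proof (Hnu _ (scal (/ beta) (Tadj beta g)) (Hk k)) as N2.
  apply Rabs_le_between in N1. apply Rabs_le_between in N2.
  apply Rabs_le_between. lra.
Qed.

(* [w] is the contribution of the bursts that start in between; the others
   cancel, as each decays by exactly [exp (- INR p * (rho * beta))]. *)
Lemma response_difference {H : CompleteNormedModule R_AbsRing}
  (ip : H -> H -> R) (Hip : is_inner_product ip)
  (T Tadj : R -> H -> H) (HT : is_C0_semigroup T)
  (HTadj : forall s, 0 <= s -> is_adjoint ip (T s) (Tadj s))
  (u0 : H) (bursts eta : R -> H) (K L : R) (HK : 0 < K) (HL : 0 <= L)
  (HetaK : forall s, 0 <= s -> norm (eta s) <= K)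
  (HetaL : forall r s, 0 <= r -> 0 <= s ->
     norm (minus (eta (r + s)) (eta r)) <= L * s)
  (u : R -> H)
  (Hu : is_mild_solution T u0 (fun s => plus (bursts s) (eta s)) u)
  (nu m : R -> H -> R) (sigma : R)
  (Hnu : forall s f, 0 <= s -> Rabs (nu s f) <= sigma)
  (Hm : forall s f, 0 <= s -> m s f = ip (u s) f + nu s f)
  (rho beta : R) (Hrho : 0 < rho) (Hb : 0 < beta)
  (C : R) (HC : 0 <= C)
  (HTC : forall s x, 0 <= s <= beta -> norm (T s x) <= C * norm x)
  (g : H) (k p : nat) (w : R -> H)
  (Hw : forall s, 0 < s < beta ->
     scal (exp (INR p * (rho * beta))) (bursts (INR (k + p) * beta + s)) =
     plus (bursts (INR k * beta + s)) (w s))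
  (HwI : ex_RInt (fun s => ip (T (beta - s) (w s)) (scal (/ beta) g)) 0 beta) :
  let c := exp (INR p * (rho * beta)) in
  let F := F_meas Tadj m beta g in
  Rabs (c * F (k + p)%nat - F k
        - RInt (fun s => ip (T (beta - s) (w s)) (scal (/ beta) g)) 0 beta)
  <= C * (INR p * c * L * beta + (c - 1) * K) * norm g + 2 * (1 + c) * sigma.
Proof.
  intros c F.
  pose (F0 := F_meas Tadj (fun s f => ip (u s) f) beta g).
  pose (y := scal (/ beta) g). fold y in HwI |- *.
  assert (Hc : 1 <= c).
  { unfold c. pose proof (pos_INR p).
    assert (0 <= INR p * (rho * beta)) by (apply Rmult_le_pos; nra).
    pose proof (exp_ineq1_le (INR p * (rho * beta))). lra. }
  assert (HE : Rabs (c * F0 (k + p)%nat - F0 k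
      - RInt (fun s => ip (T (beta - s) (w s)) y) 0 beta)
    <= beta *
       (C * (INR p * c * L * beta + (c - 1) * K) * (/ beta * norm g))).
  { assert (Hpos : 0 <= INR p * c * L * beta + (c - 1) * K).
    { apply Rplus_le_le_0_compat; [|nra].
      repeat apply Rmult_le_pos; trivial; [apply pos_INR | lra | lra]. }
    assert (Hy : norm y = / beta * norm g).
    { rewrite <- (Rabs_pos_eq (/ beta)) by (left; now apply Rinv_0_lt_compat).
      exact (norm_scal_Rabs (V := CompleteNormedModule.NormedModule _ H) _ g). }
    rewrite <- Hy. pose proof (norm_ge_0 y) as Hy0.
    eapply (is_RInt_norm_le_open (fun s =>
      c * ip (T (beta - s) (plus (bursts (INR (k + p) * beta + s))
                                 (eta (INR (k + p) * beta + s)))) y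
      - ip (T (beta - s) (plus (bursts (INR k * beta + s))
                               (eta (INR k * beta + s)))) y
      - ip (T (beta - s) (w s)) y)); [lra | | | ].
    - apply Rmult_le_pos; trivial. now apply Rmult_le_pos.
    - intros s Hs.
      pose proof (ip_T_linear ip Hip T HT (beta - s) y ltac:(lra)) as Hl.
      set (r := INR k * beta + s).
      assert (Hr : 0 <= r)
        by (unfold r; pose proof (pos_INR k); nra).
      replace (INR (k + p) * beta + s) with (r + INR p * beta)
        by (unfold r; rewrite plus_INR; ring).
      assert (Hwr := Hw s Hs). fold r c in Hwr.
      replace (INR (k + p) * beta + s) with (r + INR p * beta) in Hwr
        by (unfold r; rewrite plus_INR; ring).
      set (r' := r + INR p * beta) in *.
      set (phi := fun z => ip (T (beta - s) z) y).
      assert (Pp : forall z1 z2, phi (plus z1 z2) = phi z1 + phi z2)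
        by apply (linear_plus _ Hl).
      assert (Pm : forall z1 z2, phi (minus z1 z2) = phi z1 - phi z2)
        by (intros z1 z2; apply (linear_minus _ z1 z2 Hl)).
      assert (Ps : forall d z, phi (scal d z) = d * phi z)
        by apply (linear_scal _ Hl).
      change (Rabs (c * phi (plus (bursts r') (eta r'))
                    - phi (plus (bursts r) (eta r)) - phi (w s)) <=
              C * (INR p * c * L * beta + (c - 1) * K) * norm y).
      assert (Hphi : phi (scal c (bursts r')) = phi (plus (bursts r) (w s)))
        by now rewrite Hwr.
      rewrite Ps, Pp in Hphi. rewrite !Pp.
      (* The bursts cancel by [Hphi]. The background splits into an increment, controlled by [L],
         and a multiple of [eta r], controlled by [K]. *)
      replace (_ - _) with (c * phi (minus (eta r') (eta r)) + (c - 1) * phi (eta r))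
        by (rewrite Pm; nra).
      assert (Hbd : forall z b, norm z <= b -> Rabs (phi z) <= C * b * norm y).
      { intros z b Hz. eapply Rle_trans; [apply (Cauchy_Schwarz ip Hip)|].
        apply Rmult_le_compat_r; trivial.
        eapply Rle_trans; [apply HTC; lra|].
        now apply Rmult_le_compat_l. }
      eapply Rle_trans; [apply Rabs_triang|].
      rewrite !Rabs_mult, (Rabs_pos_eq c), (Rabs_pos_eq (c - 1)) by lra.
      replace (C * _ * norm y) with
        (c * (C * (L * (INR p * beta)) * norm y)
         + (c - 1) * (C * K * norm y)) by ring.
      apply Rplus_le_compat; apply Rmult_le_compat_l; try lra; apply Hbd.
      + apply HetaL; trivial. pose proof (pos_INR p); nra.
      + now apply HetaK.
    - apply (is_RInt_minus (V := R_NormedModule)).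
      + apply (is_RInt_minus (V := R_NormedModule)).
        * apply (is_RInt_scal (V := R_NormedModule)).
          now apply (is_RInt_response ip Hip T Tadj HT HTadj u0
            (fun s => plus (bursts s) (eta s)) u Hu).
        * now apply (is_RInt_response ip Hip T Tadj HT HTadj u0
            (fun s => plus (bursts s) (eta s)) u Hu).
      + now apply (RInt_correct (V := R_CompleteNormedModule)). }
  (* The length [beta] of the interval cancels the [/ beta] of the sampler. *)
  replace (beta * _) with
    (C * (INR p * c * L * beta + (c - 1) * K) * norm g) in HE by (field; lra).
  pose proof (F_meas_noise ip Tadj u nu m sigma Hnu Hm beta Hb g (k + p)) as N1.
  pose proof (F_meas_noise ip Tadj u nu m sigma Hnu Hm beta Hb g k) as N2.
  fold F F0 in N1, N2.
  apply Rabs_le_between in N1. apply Rabs_le_between in N2.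
  apply Rabs_le_between in HE. apply Rabs_le_between.
  split; nra.
Qed.

(** Exponential decay is memoryless: the factor [exp (INR p * (rho * beta))] undoes the decay over
    [p] steps. Here [d] marks the bursts that are inactive throughout step [k] and active throughout
    step [k + p]; a burst starting inside one of these two steps is excluded. *)
Lemma source_shift {H : CompleteNormedModule R_AbsRing} (rho : R)
  (N : nat) (t : nat -> R) (h : nat -> H) (d : nat -> R)
  (beta : R) (k p : nat) (s : R) :
  0 < s < beta ->
  (forall i, (1 <= i <= N)%nat ->
     (d i = 0 /\ (t i <= INR k * beta \/ INR (k + p + 1) * beta <= t i)) \/
     (d i = 1 /\ INR (k + 1) * beta <= t i <= INR (k + p) * beta)) ->
  let bursts s :=
    sum_n_m (fun j => scal (exp (- rho * (s - t j)) * step_at (t j) s) (h j))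
      1 N in
  scal (exp (INR p * (rho * beta))) (bursts (INR (k + p) * beta + s)) =
  plus (bursts (INR k * beta + s))
    (sum_n_m
       (fun j => scal (d j * exp (rho * (t j - INR k * beta - s))) (h j)) 1 N).
Proof.
  intros Hs Hd bursts. unfold bursts.
  rewrite <- sum_n_m_plus, <- sum_n_m_scal_l.
  apply sum_n_m_ext_loc. intros i Hi.
  rewrite scal_assoc, <- scal_distr_r. f_equal.
  change (exp (INR p * (rho * beta)) *
      (exp (- rho * (INR (k + p) * beta + s - t i))
       * step_at (t i) (INR (k + p) * beta + s)) =
    exp (- rho * (INR k * beta + s - t i)) * step_at (t i) (INR k * beta + s)
    + d i * exp (rho * (t i - INR k * beta - s))).
  rewrite <- Rmult_assoc, <- exp_plus.
  replace (INR p * (rho * beta) + - rho * (INR (k + p) * beta + s - t i))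
    with (rho * (t i - INR k * beta - s)) by (rewrite plus_INR; ring).
  replace (- rho * (INR k * beta + s - t i))
    with (rho * (t i - INR k * beta - s)) by ring.
  specialize (Hd i Hi). rewrite !plus_INR in *. simpl in Hd.
  pose proof (pos_INR p). assert (0 <= INR p * beta) by nra.
  (* All exponentials now agree, so it remains that the late indicator is the early one plus
     [d i]. *)
  unfold step_at.
  destruct Hd as [[-> [Hd | Hd]] | [-> Hd]];
    destruct (Rle_dec (t i) ((INR k + INR p) * beta + s));
    destruct (Rle_dec (t i) (INR k * beta + s)); try lra; nra.
Qed.

(** * Detection *)

Lemma slot_spec (beta t : R) :
  0 < beta -> beta <= t ->
  INR (slot beta t + 1) * beta <= t < INR (slot beta t + 2) * beta.
Proof.
  intros Hb Ht. unfold slot.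
  pose proof (base_Int_part (t / beta)) as [B1 B2].
  assert (Hq : 1 <= t / beta).
  { apply Rmult_le_reg_r with beta; trivial.
    replace (t / beta * beta) with t by (field; lra). lra. }
  (* Makes the truncated subtraction in [slot] exact. *)
  assert (H1 : (1 <= Int_part (t / beta))%Z).
  { enough (0 < Int_part (t / beta))%Z by lia. apply lt_IZR. lra. }
  assert (E : INR (Z.to_nat (Int_part (t / beta))) = IZR (Int_part (t / beta))).
  { rewrite INR_IZR_INZ, Z2Nat.id by lia. reflexivity. }
  replace (Z.to_nat (Int_part (t / beta)) - 1 + 1)%nat
    with (Z.to_nat (Int_part (t / beta))) by lia.
  replace (Z.to_nat (Int_part (t / beta)) - 1 + 2)%nat
    with (S (Z.to_nat (Int_part (t / beta)))) by lia.
  rewrite S_INR, E.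
  replace t with (t / beta * beta) at 2 3 by (field; lra).
  split; [apply Rmult_le_compat_r | apply Rmult_lt_compat_r]; lra.
Qed.

Lemma INR_mult_lt_inv (beta : R) (i j : nat) :
  0 < beta -> INR i * beta < INR j * beta -> (i < j)%nat.
Proof. intros Hb Hlt. apply INR_lt. now apply Rmult_lt_reg_r with beta. Qed.

Lemma slot_separated (beta t t' : R) :
  0 < beta -> beta <= t -> 4 * beta <= t' - t ->
  (slot beta t + 4 <= slot beta t')%nat.
Proof.
  intros Hb Ht Htt.
  pose proof (slot_spec beta t Hb Ht) as S1.
  pose proof (slot_spec beta t' Hb ltac:(lra)) as S2.
  enough (slot beta t + 5 < slot beta t' + 2)%nat by lia.
  apply (INR_mult_lt_inv beta); trivial.
  rewrite !plus_INR in *. simpl in *. lra.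
Qed.

(** The loop starts with counter 1, so a burst of slot 0 would already be behind it; this also makes
    [slot beta t - 1] a true predecessor. *)
Lemma slot_ge_1 (beta t : R) :
  0 < beta -> 2 * beta <= t -> (1 <= slot beta t)%nat.
Proof.
  intros Hb Ht. pose proof (slot_spec beta t Hb ltac:(lra)) as S1.
  enough (2 < slot beta t + 2)%nat by lia.
  apply (INR_mult_lt_inv beta); trivial. simpl (INR 2). lra.
Qed.

Lemma burst_times_separated (N : nat) (t : nat -> R) (delta : R) :
  0 <= delta -> (forall j, (1 <= j < N)%nat -> delta <= t (S j) - t j) ->
  forall i j, (1 <= i)%nat -> (i < j <= N)%nat -> delta <= t j - t i.
Proof.
  intros Hd Hsep i j Hi. induction j as [|j IH]; intros Hj; [lia|].
  assert (Hlast := Hsep j ltac:(lia)).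
  destruct (Nat.eq_dec i j) as [-> | Hij]; [exact Hlast|].
  specialize (IH ltac:(lia)). lra.
Qed.

Lemma StronglySorted_seq (Rel : nat -> nat -> Prop) (len start : nat) :
  (forall i j, (start <= i)%nat -> (i < j < start + len)%nat -> Rel i j) ->
  StronglySorted Rel (List.seq start len).
Proof.
  revert start. induction len as [|len IH]; intros start Hrel; simpl.
  - constructor.
  - constructor.
    + apply IH. intros i j Hi Hj. apply Hrel; lia.
    + apply Forall_forall. intros j Hj. apply in_seq in Hj. apply Hrel; lia.
Qed.

(** Depends on the slot alone, not on the path of the loop: a large [Delta] at [n] is met by the
    first test at counter [n] or by the second one at [n - 1], and both emit the same pair. *)
Definition detected_shape (rho beta Q : R) (F : nat -> R) (n : nat) : R :=
  if Rlt_dec Q (Rabs (Defs.Delta rho beta F n))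
  then exp (3 * rho * beta) * F (n + 2)%nat - F (n - 1)%nat
  else exp (3 * rho * beta) * F (n + 3)%nat - F n.

Definition detected_time (rho beta Q : R) (F : nat -> R) (n : nat) : R :=
  if Rlt_dec Q (Rabs (Defs.Delta rho beta F n))
  then INR (n + 1) * beta else INR (n + 2) * beta.

(* The loop invariant: [l] lists the bursts still to come, and every later
   [Delta] that none of them accounts for is below the threshold. The loop meets
   a detected burst of slot [n] with counter [n - 1] or [n], and leaves it with
   [n + 2] or [n + 3]; a missed burst may be dropped from [l]. [d] bounds the
   number of remaining iterations. *)
Lemma algorithm_loop_detects_bursts (rho beta Q Tmax : R) (F t : nat -> R) :
  0 < beta ->
  forall (d i : nat) (l : list nat),
  Tmax <= INR (i + d) * beta -> (1 <= i)%nat ->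
  StronglySorted (fun j j' => slot beta (t j) + 4 <= slot beta (t j'))%nat l ->
  (forall j, In j l ->
     (i <= slot beta (t j))%nat /\ INR (slot beta (t j) + 1) * beta < Tmax) ->
  (forall k, (i <= k)%nat ->
     (forall j, In j l ->
        k <> slot beta (t j) /\ k <> (slot beta (t j) + 1)%nat) ->
     Rabs (Defs.Delta rho beta F k) <= Q) ->
  algorithm_loop rho beta Q Tmax F i
    (map (fun j => (detected_shape rho beta Q F (slot beta (t j)),
                    detected_time rho beta Q F (slot beta (t j))))
       (filter (fun j => detected rho beta Q F (t j)) l)).
Proof.
  intros Hb.
  assert (Hexit : forall i l, Tmax <= INR i * beta ->
    (forall j, In j l ->
      (i <= slot beta (t j))%nat /\ INR (slot beta (t j) + 1) * beta < Tmax) ->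
    l = nil).
  { intros i [|j l] Hi Hl; trivial. exfalso.
    destruct (Hl j (or_introl eq_refl)) as [H1 H2].
    apply (Rlt_le_trans _ _ _ H2) in Hi.
    apply INR_mult_lt_inv in Hi; trivial. lia. }
  induction d as [|d IHd]; intros i l Hd Hi Hsort Hslot Hquiet.
  { rewrite Nat.add_0_r in Hd. rewrite (Hexit i l Hd Hslot).
    now constructor. }
  destruct (Rle_lt_dec Tmax (INR i * beta)) as [Hstop | Hgo].
  { rewrite (Hexit i l Hstop Hslot). now constructor. }
  assert (Hlater : forall e, (1 <= e)%nat -> Tmax <= INR (i + e + d) * beta).
  { intros e He. eapply Rle_trans; [exact Hd|].
    apply Rmult_le_compat_r; [lra|]. apply le_INR. lia. }
  (* Inner induction on the list: dropping a missed burst uses up no iteration. *)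
  induction l as [|j l IHl].
  { simpl. apply loop_skip; trivial; try (apply Hquiet; [lia|]; now intros j []).
    apply (IHd (i + 1)%nat nil); trivial; [apply Hlater; lia | lia | now intros j [] |].
    intros k Hk. apply Hquiet. lia. }
  apply StronglySorted_inv in Hsort as [Hsort Hj].
  rewrite Forall_forall in Hj.
  destruct (Hslot j (or_introl eq_refl)) as [Hij HjT].
  remember (slot beta (t j)) as n eqn:En.
  assert (Hn : forall j', In j' l -> (n + 4 <= slot beta (t j'))%nat /\
             INR (slot beta (t j') + 1) * beta < Tmax).
  { intros j' Hj'. split; [now apply Hj | now apply Hslot; right]. }
  assert (Hq : forall k, (i <= k)%nat -> k <> n -> k <> (n + 1)%nat ->
    (forall j', In j' l ->
       k <> slot beta (t j') /\ k <> (slot beta (t j') + 1)%nat) ->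
    Rabs (Defs.Delta rho beta F k) <= Q).
  { intros k Hk H1 H2 H3. apply Hquiet; trivial.
    intros j' [<- | Hj']; [rewrite <- En; now split | now apply H3]. }
  assert (Hdet : detected rho beta Q F (t j) =
    if Rlt_dec Q (Rabs (Defs.Delta rho beta F n)) then true
    else if Rlt_dec Q (Rabs (Defs.Delta rho beta F (n + 1))) then true else false)
    by (unfold detected; now rewrite <- En).
  assert (Hskip : (i < n - 1)%nat \/ (i = n - 1)%nat /\ (i < n)%nat /\
      Rabs (Defs.Delta rho beta F n) <= Q ->
    algorithm_loop rho beta Q Tmax F i
    (map (fun j => (detected_shape rho beta Q F (slot beta (t j)),
                    detected_time rho beta Q F (slot beta (t j))))
       (filter (fun j => detected rho beta Q F (t j)) (j :: l)))).
  { intros Hin. apply loop_skip; trivial.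
    - apply Hq; try lia. intros j' Hj'. apply Hn in Hj'. lia.
    - destruct Hin as [Hin | [Hin [Hin' Hsmall]]].
      + apply Hq; try lia. intros j' Hj'. apply Hn in Hj'. lia.
      + now replace (i + 1)%nat with n by lia.
    - apply IHd; [apply Hlater; lia | lia | | |].
      + constructor; trivial. apply Forall_forall. now rewrite <- En.
      + intros j' [<- | Hj']; [rewrite <- En; split; trivial; lia|].
        destruct (Hn j' Hj'). split; trivial; lia.
      + intros k Hk. apply Hquiet. lia. }
  (* After a detection the counter is past step [n + 1], hence past both traces of this burst, and
     still below the next slot, which is at least [n + 4]. *)
  assert (Hrest : forall e, (n + 2 <= i + e <= n + 3)%nat ->
    (1 <= e)%nat ->
    algorithm_loop rho beta Q Tmax F (i + e)
    (map (fun j => (detected_shape rho beta Q F (slot beta (t j)),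
                    detected_time rho beta Q F (slot beta (t j))))
       (filter (fun j => detected rho beta Q F (t j)) l))).
  { intros e He1 He2. apply IHd; trivial; [now apply Hlater | lia | |].
    - intros j' Hj'. destruct (Hn j' Hj'). split; trivial; lia.
    - intros k Hk. apply Hq; lia. }
  simpl in Hskip |- *. rewrite Hdet in Hskip |- *.
  destruct (Rlt_dec Q (Rabs (Defs.Delta rho beta F n))) as [Hd1 | Hd1].
  - assert (Hcase : (i < n - 1 \/ (i = n - 1 /\ i < n) \/ i = n)%nat) by lia.
    destruct Hcase as [Hcase | [[Hcase Hcase'] | ->]].
    + apply Hskip. now left.
    + simpl. rewrite <- En.
      replace (detected_shape rho beta Q F n) with
        (exp (3 * rho * beta) * F (i + 3)%nat - F i).
      2:{ unfold detected_shape. destruct Rlt_dec; [|contradiction].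
          replace (i + 3)%nat with (n + 2)%nat by lia.
          now replace i with (n - 1)%nat. }
      replace (detected_time rho beta Q F n) with (INR (i + 2) * beta).
      2:{ unfold detected_time. destruct Rlt_dec; [|contradiction].
          now replace (i + 2)%nat with (n + 1)%nat by lia. }
      apply loop_detect_next; trivial.
      * apply Hq; try lia. intros j' Hj'. apply Hn in Hj'. lia.
      * now replace (i + 1)%nat with n by lia.
      * apply Hrest; lia.
    + simpl. rewrite <- En. unfold detected_shape at 1, detected_time at 1.
      destruct Rlt_dec; [|contradiction].
      apply loop_detect; trivial. apply Hrest; lia.
  - apply Rnot_lt_le in Hd1.
    destruct (Rlt_dec Q (Rabs (Defs.Delta rho beta F (n + 1)))) as [Hd2 | Hd2].
    + assert (Hcase : (i < n - 1 \/ (i = n - 1 /\ i < n) \/ i = n)%nat) by lia.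
      destruct Hcase as [Hcase | [[Hcase Hcase'] | ->]].
      * apply Hskip. now left.
      * apply Hskip. right. now split.
      * simpl. rewrite <- En. unfold detected_shape at 1, detected_time at 1.
        destruct Rlt_dec; [lra|].
        apply loop_detect_next; trivial. apply Hrest; lia.
    (* A missed burst: both of its differences are below the threshold, so they join the quiet
       steps. *)
    + apply Rnot_lt_le in Hd2. apply IHl; trivial.
      * intros j' Hj'. apply Hslot. now right.
      * intros k Hk Hout.
        destruct (Nat.eq_dec k n) as [-> | H1]; trivial.
        destruct (Nat.eq_dec k (n + 1)) as [-> | H2]; trivial.
        now apply Hq.
Qed.

(** * Error estimates *)

(** Stated for any uniform bound [C] of the semigroup on one step and any [Q], [B] above the
    resulting errors, so that it serves both nonnegative [a] with arbitrary steps and arbitrary [a]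
    with small steps. *)
Lemma algorithm_accuracy {H : CompleteNormedModule R_AbsRing}
  (ip : H -> H -> R) (Hip : is_inner_product ip)
  (T Tadj : R -> H -> H) (HT : is_C0_semigroup T)
  (HTadj : forall s, 0 <= s -> is_adjoint ip (T s) (Tadj s))
  (M a : R) (HM : 1 <= M)
  (HMa : forall s x, 0 <= s -> norm (T s x) <= M * exp (a * s) * norm x)
  (u0 : H) (rho : R) (Hrho : 0 < rho)
  (N : nat) (t : nat -> R) (h : nat -> H)
  (eta : R -> H) (K L : R) (HK : 0 < K) (HL : 0 <= L)
  (HetaK : forall s, 0 <= s -> norm (eta s) <= K)
  (HetaL : forall r s, 0 <= r -> 0 <= s ->
     norm (minus (eta (r + s)) (eta r)) <= L * s)
  (u : R -> H) (Hu : is_mild_solution T u0 (source rho N t h eta) u)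
  (nu m : R -> H -> R) (sigma : R)
  (Hnu : forall s f, 0 <= s -> Rabs (nu s f) <= sigma)
  (Hm : forall s f, 0 <= s -> m s f = ip (u s) f + nu s f)
  (beta Tmax : R) (g : H) (Hb : 0 < beta)
  (Hsep : forall j, (1 <= j < N)%nat -> 4 * beta <= t (S j) - t j)
  (Ht : forall j, (1 <= j <= N)%nat -> 2 * beta <= t j < Tmax)
  (C : R) (HC : 0 <= C)
  (HTC : forall s x, 0 <= s <= beta -> norm (T s x) <= C * norm x)
  (Q B : R)
  (HQ : C * (exp (rho * beta) * L * beta + (exp (rho * beta) - 1) * K) * norm g
        + 2 * (1 + exp (rho * beta)) * sigma <= Q)
  (HB : C * (3 * exp (3 * rho * beta) * L * beta
             + (exp (3 * rho * beta) - 1) * K) * norm g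
        + 2 * (1 + exp (3 * rho * beta)) * sigma <= B) :
  let F := F_meas Tadj m beta g in
  exists tt ff : nat -> R,
    burst_outputs rho beta Q Tmax F N t tt ff /\
    forall j, (1 <= j <= N)%nat ->
      (detected rho beta Q F (t j) = true -> Rabs (tt j - t j) <= beta) /\
      Rabs (ff j - ip (h j) g) <=
        B + 2 * exp (rho * beta) * Q
        + Rmax (v ip T rho beta 0 (t j) (h j) g) (v ip T rho beta 1 (t j) (h j) g).
Proof.
  intros F.
  assert (Hsigma : 0 <= sigma)
    by (eapply Rle_trans; [apply Rabs_pos | apply (Hnu 0 g); lra]).
  pose (n := fun j => slot beta (t j)).
  assert (Hn : forall j, (1 <= j <= N)%nat -> (1 <= n j)%nat /\
    INR (n j + 1) * beta <= t j < INR (n j + 2) * beta).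
  { intros j Hj. destruct (Ht j Hj) as [Htj _]. split.
    - apply slot_ge_1; trivial.
    - apply slot_spec; lra. }
  assert (Hnn : forall i j, (1 <= i)%nat -> (i < j <= N)%nat -> (n i + 4 <= n j)%nat).
  { intros i j Hi Hj. apply slot_separated; trivial.
    - destruct (Ht i ltac:(lia)); lra.
    - apply (burst_times_separated N t (4 * beta) ltac:(lra) Hsep i j Hi Hj). }
  assert (Hmul : forall i j, (i <= j)%nat -> INR i * beta <= INR j * beta).
  { intros i j Hij. apply Rmult_le_compat_r; [lra|]. now apply le_INR. }
  (* The error of [response_difference] over [p] steps: [p = 1] governs detection, [p = 3] the
     emitted shape, [p = 2] a missed burst. *)
  pose (E := fun p => C * (INR p * exp (INR p * (rho * beta)) * L * beta
      + (exp (INR p * (rho * beta)) - 1) * K) * norm g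
      + 2 * (1 + exp (INR p * (rho * beta))) * sigma).
  assert (HE1 : E 1%nat <= Q).
  { unfold E. simpl INR. rewrite !Rmult_1_l. exact HQ. }
  assert (HE3 : E 3%nat <= B).
  { unfold E. replace (INR 3) with 3 by (simpl; ring).
    now rewrite <- Rmult_assoc. }
  assert (HEmono : forall p q, (p <= q)%nat -> E p <= E q).
  { intros p q Hpq. unfold E. apply le_INR in Hpq. pose proof (pos_INR p).
    assert (0 < rho * beta) by now apply Rmult_lt_0_compat.
    assert (Hexp : exp (INR p * (rho * beta)) <= exp (INR q * (rho * beta)))
      by (apply exp_monotone; nra).
    pose proof (exp_pos (INR p * (rho * beta))).
    apply Rplus_le_compat; [|nra].
    apply Rmult_le_compat_r; [apply norm_ge_0|].
    apply Rmult_le_compat_l; trivial.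
    apply Rplus_le_compat; [|nra].
    apply Rmult_le_compat_r; [lra|]. apply Rmult_le_compat_r; trivial.
    apply Rmult_le_compat; lra. }
  pose proof (fun k p w => response_difference ip Hip T Tadj HT HTadj u0 _ eta
    K L HK HL HetaK HetaL u Hu nu m sigma Hnu Hm rho beta Hrho Hb C HC HTC
    g k p w) as Hresp.
  cbv zeta in Hresp. fold F in Hresp.
  (* No false alarm: no burst starts in step [k] or [k + 1], so the surviving term is zero. *)
  assert (Hquiet : forall k,
    (forall i, (1 <= i <= N)%nat -> k <> n i /\ k <> (n i + 1)%nat) ->
    Rabs (Defs.Delta rho beta F k) <= Q).
  { intros k Hk.
    assert (W0 : forall s, 0 < s < beta ->
      ip (T (beta - s) zero) (scal (/ beta) g) = 0).
    { intros s Hs. exact (linear_zero _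
        (ip_T_linear ip Hip T HT (beta - s) (scal (/ beta) g) ltac:(lra))). }
    assert (WI : is_RInt (fun s => ip (T (beta - s) zero) (scal (/ beta) g))
                   0 beta 0).
    { apply is_RInt_ext with (fun _ => 0).
      - rewrite Rmin_left, Rmax_right by lra. intros s Hs. now rewrite W0.
      - replace 0 with (scal (beta - 0) 0) at 2 by apply Rmult_0_r.
        apply (is_RInt_const (V := R_NormedModule)). }
    specialize (Hresp k 1%nat (fun _ => zero)). cbv beta in Hresp.
    rewrite (is_RInt_unique _ _ _ _ WI) in Hresp.
    replace (Defs.Delta rho beta F k) with
      (exp (INR 1 * (rho * beta)) * F (k + 1)%nat - F k - 0).
    2:{ unfold Defs.Delta. rewrite Nat.add_1_r.
        replace (INR 1 * (rho * beta)) with (rho * beta) by (simpl; ring). ring. }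
    eapply Rle_trans; [apply Hresp | exact HE1]; [|now exists 0].
    intros s Hs.
    rewrite (source_shift rho N t h (fun _ => 0) beta k 1 s Hs).
    - f_equal.
      rewrite (sum_n_m_ext_loc _ (fun _ => zero)).
      + apply sum_n_m_const_zero.
      + intros i _. rewrite Rmult_0_l. apply (scal_zero_l (h i)).
    - intros i Hi. left. split; trivial.
      destruct (Hn i Hi) as [_ Hti]. destruct (Hk i Hi).
      destruct (Nat.lt_ge_cases k (n i)) as [Hlt | Hge].
      + right. pose proof (Hmul (k + 1 + 1)%nat (n i + 1)%nat ltac:(lia)). lra.
      + left. pose proof (Hmul (n i + 2)%nat k ltac:(lia)). lra. }
  (* The window from step [k] to [k + p] contains the start of burst [j] and is short enough to miss
     its neighbours, at least 4 slots away. The offset [k'] of [k] from the slot selects [v_0] or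
     [v_1]. *)
  assert (Hjump : forall j, (1 <= j <= N)%nat -> forall k k' p,
    (k + k' = n j)%nat -> (k' <= 1)%nat -> (n j + 2 <= k + p <= n j + 3)%nat ->
    Rabs (exp (INR p * (rho * beta)) * F (k + p)%nat - F k - ip (h j) g)
      <= E p + v ip T rho beta k' (t j) (h j) g).
  { intros j Hj k k' p Hk Hk' Hp.
    assert (Ek : INR (slot beta (t j)) - INR k' = INR k).
    { fold (n j). rewrite <- Hk, plus_INR. ring. }
    unfold v. rewrite Ek.
    specialize (Hresp k p
      (fun s => scal (exp (rho * (t j - INR k * beta - s))) (h j))).
    match type of Hresp with _ -> _ -> Rabs (?x - ?I) <= _ =>
      replace (x - ip (h j) g) with ((x - I) + (I - ip (h j) g)) by ring
    end.
    eapply Rle_trans; [apply Rabs_triang|]. apply Rplus_le_compat_r.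
    apply Hresp.
    - intros s Hs.
      rewrite (source_shift rho N t h (fun i => if Nat.eqb i j then 1 else 0)
                 beta k p s Hs).
      + f_equal. rewrite (sum_n_m_single _ j N Hj).
        * now rewrite Nat.eqb_refl, Rmult_1_l.
        * intros i _ Hij. apply Nat.eqb_neq in Hij.
          rewrite Hij, Rmult_0_l. apply (scal_zero_l (h i)).
      + intros i Hi. destruct (Hn i Hi) as [_ Hti].
        destruct (Nat.eqb_spec i j) as [-> | Hij].
        * right. split; trivial.
          pose proof (Hmul (k + 1)%nat (n j + 1)%nat ltac:(lia)).
          pose proof (Hmul (n j + 2)%nat (k + p)%nat ltac:(lia)). lra.
        * left. split; trivial.
          destruct (Nat.lt_gt_cases i j) as [Hlt _].
          destruct (Hlt Hij) as [Hl | Hl].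
          -- left. pose proof (Hnn i j ltac:(lia) ltac:(lia)).
             pose proof (Hmul (n i + 2)%nat k ltac:(lia)). lra.
          -- right. pose proof (Hnn j i ltac:(lia) ltac:(lia)).
             pose proof (Hmul (k + p + 1)%nat (n i + 1)%nat ltac:(lia)). lra.
    - apply (ex_RInt_burst_response ip Hip T HT M a HM HMa). lra. }
  exists (fun j => detected_time rho beta Q F (n j)).
  exists (fun j => if detected rho beta Q F (t j)
                   then detected_shape rho beta Q F (n j) else 0).
  split; [split|].
  - rewrite (map_ext_in _ (fun j => (detected_shape rho beta Q F (slot beta (t j)),
                    detected_time rho beta Q F (slot beta (t j))))).
    2:{ intros j Hj. apply filter_In in Hj as [_ Hj]. now rewrite Hj. }
    (* Enough iterations to pass [Tmax] from counter 1; [Rmax 0] covers a negative horizon. *)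
    destruct (nfloor_ex (Rmax 0 (Tmax / beta)) (Rmax_l _ _)) as [d [_ Hd]].
    apply (algorithm_loop_detects_bursts rho beta Q Tmax F t Hb d); trivial.
    + replace Tmax with (Tmax / beta * beta) by (field; lra).
      apply Rmult_le_compat_r; [lra|].
      rewrite plus_INR. pose proof (Rmax_r 0 (Tmax / beta)). simpl; lra.
    + apply StronglySorted_seq. intros i j Hi Hj. apply Hnn; lia.
    + intros j Hj. apply in_seq in Hj.
      destruct (Hn j ltac:(lia)) as [H1 H2]. split; trivial.
      destruct (Ht j ltac:(lia)). unfold n in H2. lra.
    + intros k Hk Hout. apply Hquiet. intros i Hi. apply Hout.
      apply in_seq. lia.
  - intros j _ Hj. now rewrite Hj.
  - intros j Hj. destruct (Hn j Hj) as [Hn1 [Hlo Hhi]].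
    rewrite !plus_INR in Hlo, Hhi. simpl in Hlo, Hhi.
    split.
    (* The emitted time is an end point of the step of length [beta] that contains the burst. *)
    { intros _. unfold detected_time. apply Rabs_le_between.
      destruct Rlt_dec; rewrite plus_INR; simpl; lra. }
    pose proof (Rmax_l (v ip T rho beta 0 (t j) (h j) g)
                       (v ip T rho beta 1 (t j) (h j) g)) as V0.
    pose proof (Rmax_r (v ip T rho beta 0 (t j) (h j) g)
                       (v ip T rho beta 1 (t j) (h j) g)) as V1.
    assert (Hc : 1 <= exp (rho * beta)).
    { pose proof (exp_ineq1_le (rho * beta)). nra. }
    assert (H3 : exp (3 * rho * beta) = exp (INR 3 * (rho * beta)))
      by (f_equal; simpl; ring).
    (* [Q] dominates [E 0], which equals [4 * sigma]. *)
    assert (HQ0 : 0 <= Q).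
    { eapply Rle_trans; [|exact HE1]. eapply Rle_trans; [|apply (HEmono 0%nat); lia].
      unfold E. simpl INR. rewrite !Rmult_0_l, exp_0. lra. }
    assert (HeQ : 0 <= exp (rho * beta) * Q) by (apply Rmult_le_pos; lra).
    unfold detected, detected_shape. fold (n j).
    destruct (Rlt_dec Q (Rabs (Defs.Delta rho beta F (n j)))) as [Hd1 | Hd1].
    + pose proof (Hjump j Hj (n j - 1)%nat 1%nat 3%nat
                    ltac:(lia) ltac:(lia) ltac:(lia)) as HJ.
      replace (n j - 1 + 3)%nat with (n j + 2)%nat in HJ by lia.
      rewrite H3. lra.
    + destruct (Rlt_dec Q (Rabs (Defs.Delta rho beta F (n j + 1)))) as [Hd2 | Hd2].
      * pose proof (Hjump j Hj (n j) 0%nat 3%nat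
                      ltac:(lia) ltac:(lia) ltac:(lia)) as HJ.
        rewrite H3. lra.
      * pose proof (Hjump j Hj (n j) 0%nat 2%nat
                      ltac:(lia) ltac:(lia) ltac:(lia)) as HJ.
        pose proof (HEmono 2%nat 3%nat ltac:(lia)) as HE23.
        apply Rnot_lt_le in Hd1, Hd2.
        (* For a missed burst the output is 0, so [ip (h j) g] itself must be small. The two-step
           difference telescopes into two quiet values of [Delta], and [exp (rho * beta) + 1 <= 2 *
           exp (rho * beta)]. *)
        assert (Hsum : Rabs (exp (INR 2 * (rho * beta)) * F (n j + 2)%nat - F (n j))
                  <= 2 * exp (rho * beta) * Q).
        { replace (exp (INR 2 * (rho * beta)))
            with (exp (rho * beta) * exp (rho * beta))
            by (rewrite <- exp_plus; f_equal; simpl; ring).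
          replace (_ - _) with
            (exp (rho * beta) * Defs.Delta rho beta F (n j + 1)
             + Defs.Delta rho beta F (n j))
            by (unfold Defs.Delta; replace (S (n j + 1)) with (n j + 2)%nat by lia;
                rewrite <- (Nat.add_1_r (n j)); ring).
          eapply Rle_trans; [apply Rabs_triang|].
          rewrite Rabs_mult, (Rabs_pos_eq (exp (rho * beta))) by lra. nra. }
        apply Rabs_le_between in HJ. apply Rabs_le_between in Hsum.
        apply Rabs_le_between. lra.
Qed.

(** Makes [v] small for short steps. Writing [ip hj g] as an integral over the step splits the
    integrand into a part from the exponential weight and a part from [T (beta - s) hj - hj]. *)
Lemma v_bound {H : CompleteNormedModule R_AbsRing}
  (ip : H -> H -> R) (Hip : is_inner_product ip)
  (T : R -> H -> H) (HT : is_C0_semigroup T)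
  (M a : R) (HM : 1 <= M)
  (HMa : forall s x, 0 <= s -> norm (T s x) <= M * exp (a * s) * norm x)
  (rho : R) (Hrho : 0 < rho) (beta tj : R) (Hb : 0 < beta) (Htj : 2 * beta <= tj)
  (C : R) (HC : 0 <= C)
  (HTC : forall s x, 0 <= s <= beta -> norm (T s x) <= C * norm x)
  (k : nat) (Hk : (k <= 1)%nat) (hj g : H) (eps : R) (Heps : 0 <= eps)
  (Hsmall : forall s, 0 <= s <= beta -> norm (minus (T s hj) hj) <= eps) :
  v ip T rho beta k tj hj g <=
    norm g * (C * norm hj * (exp (3 * rho * beta) - 1) + eps).
Proof.
  pose proof (slot_spec beta tj Hb ltac:(lra)) as Hslot.
  rewrite !plus_INR in Hslot. simpl in Hslot.
  assert (Hk1 : 0 <= INR k <= 1) by (split; [apply pos_INR | now apply (le_INR k 1)]).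
  assert (Hkb : 0 <= INR k * beta <= beta) by nra.
  unfold v. set (r := tj - (INR (slot beta tj) - INR k) * beta).
  (* Since [k <= 1], the exponent [rho * (r - s)] stays between 0 and [3 * rho * beta]. *)
  assert (Hr : beta <= r <= 3 * beta) by (unfold r; nra).
  set (y := scal (/ beta) g).
  assert (Hy : norm y = / beta * norm g).
  { rewrite <- (Rabs_pos_eq (/ beta)) by (left; now apply Rinv_0_lt_compat).
    exact (norm_scal_Rabs (V := CompleteNormedModule.NormedModule _ H) _ g). }
  assert (Hyip : ip hj g = (beta - 0) * ip hj y).
  { unfold y. rewrite (ip_sym _ Hip hj (scal _ _)), (ip_scal_l _ Hip),
      (ip_sym _ Hip g). field; lra. }
  rewrite Hyip.
  pose proof (norm_ge_0 y) as Hy0. pose proof (norm_ge_0 hj) as Hh0.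
  assert (Hexp3 : 1 <= exp (3 * rho * beta)).
  { pose proof (exp_ineq1_le (3 * rho * beta)). nra. }
  set (c := C * norm hj * (exp (3 * rho * beta) - 1) + eps).
  assert (Hc : 0 <= c).
  { apply Rplus_le_le_0_compat; trivial.
    repeat apply Rmult_le_pos; trivial; lra. }
  replace (norm g * c) with (beta * (c * norm y)) by (rewrite Hy; field; lra).
  apply (is_RInt_norm_le_open (fun s =>
    ip (T (beta - s) (scal (exp (rho * (r - s))) hj)) y - ip hj y));
    [lra | now apply Rmult_le_pos | |].
  - intros s Hs.
    rewrite (linear_scal (T (beta - s))) by (apply (sg_linear _ HT); lra).
    rewrite (ip_scal_l _ Hip).
    set (e := exp (rho * (r - s))).
    assert (He : 1 <= e <= exp (3 * rho * beta)).
    { unfold e. split.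
      - rewrite <- exp_0. apply exp_monotone. nra.
      - apply exp_monotone. nra. }
    replace (_ - _) with ((e - 1) * ip (T (beta - s) hj) y
                          + ip (minus (T (beta - s) hj) hj) y).
    2:{ rewrite (linear_minus _ _ _ (ip_linear_l ip Hip y)).
        unfold minus, plus, opp; simpl. ring. }
    eapply Rle_trans; [apply Rabs_triang|].
    unfold c. rewrite Rmult_plus_distr_r. apply Rplus_le_compat.
    + rewrite Rabs_mult, (Rabs_pos_eq (e - 1)) by lra.
      replace (C * norm hj * (exp (3 * rho * beta) - 1) * norm y)
        with ((exp (3 * rho * beta) - 1) * (C * norm hj * norm y)) by ring.
      apply Rmult_le_compat; [lra | apply Rabs_pos | lra |].
      eapply Rle_trans; [apply (Cauchy_Schwarz ip Hip)|].
      apply Rmult_le_compat_r; trivial. apply HTC; lra.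
    + eapply Rle_trans; [apply (Cauchy_Schwarz ip Hip)|].
      apply Rmult_le_compat_r; trivial. apply Hsmall; lra.
  - apply (is_RInt_minus (V := R_NormedModule)).
    + apply (RInt_correct (V := R_CompleteNormedModule)).
      apply (ex_RInt_burst_response ip Hip T HT M a HM HMa). lra.
    + apply (is_RInt_const (V := R_NormedModule)).
Qed.

(** For negative [a] the factor [exp (a * s)] is largest at [s = 0], hence [Rmax a 0]. *)
Lemma semigroup_bound {H : CompleteNormedModule R_AbsRing}
  (T : R -> H -> H) (M a : R) (HM : 1 <= M)
  (HMa : forall s x, 0 <= s -> norm (T s x) <= M * exp (a * s) * norm x)
  (beta s : R) (x : H) :
  0 <= s <= beta -> norm (T s x) <= M * exp (Rmax a 0 * beta) * norm x.
Proof.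
  intros Hs. eapply Rle_trans; [apply HMa; lra|].
  apply Rmult_le_compat_r; [apply norm_ge_0|].
  apply Rmult_le_compat_l; [lra|]. apply exp_monotone.
  pose proof (Rmax_l a 0). pose proof (Rmax_r a 0). nra.
Qed.

(* The spare noise budget [2 (exp (p rho beta) - 1) sigma] absorbs the excess of
   the uniform bound [C] of the semigroup on [[0, beta]] over
   [M exp (a beta)]. *)
Lemma noise_slack (C M a rho beta L K sigma normg p : R) :
  let c := exp (p * rho * beta) in
  (C - M * exp (a * beta)) * (p * c * L * beta + (c - 1) * K) * normg
    <= 2 * (c - 1) * sigma ->
  C * (p * c * L * beta + (c - 1) * K) * normg + 2 * (1 + c) * sigma
  <= p * exp ((p * rho + a) * beta) * M * L * normg * beta
     + exp (a * beta) * (c - 1) * M * K * normg + 4 * c * sigma.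
Proof.
  intros c Hslack.
  replace (exp ((p * rho + a) * beta)) with (c * exp (a * beta))
    by (unfold c; rewrite <- exp_plus; f_equal; ring).
  lra.
Qed.

(** As [c - 1 >= p * rho * beta], the whole background term is [c - 1] times a bounded factor.
    Dividing by [c - 1] leaves a condition that holds for small [beta] once [C - M * exp (a * beta)]
    tends to 0. *)
Lemma noise_slack_small_step (C M a rho beta L K sigma normg p : R) :
  0 < rho -> 0 < beta -> 0 <= L -> 0 < K -> 0 <= sigma -> 0 <= normg ->
  1 <= p <= 3 -> M * exp (a * beta) <= C ->
  (C - M * exp (a * beta)) * (exp (3 * rho * beta) * L / rho + K) * normg
    <= 2 * sigma ->
  let c := exp (p * rho * beta) in
  (C - M * exp (a * beta)) * (p * c * L * beta + (c - 1) * K) * normg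
    <= 2 * (c - 1) * sigma.
Proof.
  intros Hrho Hb HL HK Hsigma Hg Hp HC Hsmall c.
  assert (Hrb : 0 < rho * beta) by now apply Rmult_lt_0_compat.
  assert (Hc : p * rho * beta <= c - 1)
    by (pose proof (exp_ineq1_le (p * rho * beta)); unfold c; lra).
  assert (Hc0 : 0 <= c - 1) by nra.
  assert (Hc3 : c <= exp (3 * rho * beta)) by (apply exp_monotone; nra).
  assert (HLc : p * c * L * beta <= (c - 1) * (exp (3 * rho * beta) * L / rho)).
  { replace (p * c * L * beta) with (p * rho * beta * (c * (L / rho)))
      by (field; lra).
    assert (HLr : 0 <= L / rho) by (apply Rdiv_le_0_compat; lra).
    replace (exp (3 * rho * beta) * L / rho)
      with (exp (3 * rho * beta) * (L / rho)) by (field; lra).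
    apply Rmult_le_compat; [nra | apply Rmult_le_pos; lra | exact Hc |].
    now apply Rmult_le_compat_r. }
  apply Rle_trans with
    ((C - M * exp (a * beta))
     * ((c - 1) * (exp (3 * rho * beta) * L / rho + K)) * normg).
  - apply Rmult_le_compat_r; trivial. apply Rmult_le_compat_l; lra.
  - replace (_ * normg) with ((c - 1) * ((C - M * exp (a * beta))
      * (exp (3 * rho * beta) * L / rho + K) * normg)) by ring.
    apply Rle_trans with ((c - 1) * (2 * sigma)); [|lra].
    now apply Rmult_le_compat_l.
Qed.

(** * Conditions that hold for all small time steps *)

Lemma at_right_continuous_lt (f : R -> R) (c : R) :
  ex_derive f 0 -> f 0 < c -> at_right 0 (fun b => f b < c).
Proof.
  intros Hf Hc. apply filter_le_within.
  apply (ex_derive_continuous f 0 Hf (fun z => z < c)).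
  now apply open_lt.
Qed.

Lemma filter_forall_range {X : Type} (F : (X -> Prop) -> Prop) {FF : Filter F}
  (P : nat -> X -> Prop) (N : nat) :
  (forall j, (1 <= j <= N)%nat -> F (P j)) ->
  F (fun x => forall j, (1 <= j <= N)%nat -> P j x).
Proof.
  induction N as [|N IH]; intros HP.
  - apply filter_forall. intros x j Hj. lia.
  - apply filter_imp with
      (fun x => (forall j, (1 <= j <= N)%nat -> P j x) /\ P (S N) x).
    + intros x [H1 H2] j Hj.
      destruct (Nat.eq_dec j (S N)) as [-> | Hne]; [trivial | apply H1; lia].
    + apply filter_and; [apply IH; intros j Hj|]; apply HP; lia.
Qed.

Theorem theorem3p3
  (H : CompleteNormedModule R_AbsRing) (ip : H -> H -> R)
  (Hip : is_inner_product ip)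
  (D : H -> Prop) (A : H -> H) (T Tadj : R -> H -> H)
  (HT : is_C0_semigroup T) (HA : generates D A T)
  (HTadj : forall s, 0 <= s -> is_adjoint ip (T s) (Tadj s))
  (M a : R) (HM : 1 <= M)
  (HMa : forall s x, 0 <= s -> norm (T s x) <= M * exp (a * s) * norm x)
  (u0 : H) (rho : R) (Hrho : 0 < rho)
  (N : nat) (t : nat -> R) (h : nat -> H) (Ht : burst_times N t)
  (eta : R -> H) (K L : R) (HK : 0 < K) (HL : 0 <= L)
  (HetaK : forall s, 0 <= s -> norm (eta s) <= K)
  (HetaL : forall r s, 0 <= r -> 0 <= s ->
     norm (minus (eta (r + s)) (eta r)) <= L * s)
  (u : R -> H) (Hu : is_mild_solution T u0 (source rho N t h eta) u)
  (nu m : R -> H -> R) (sigma : R)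
  (Hnu : forall s f, 0 <= s -> Rabs (nu s f) <= sigma)
  (Hm : forall s f, 0 <= s -> m s f = ip (u s) f + nu s f)
  (Gt : H -> Prop) (HGt : countable_set Gt) :
  (0 <= a ->
   forall (beta Tmax : R) (g : H),
     0 < beta ->
     (forall j, (1 <= j < N)%nat -> 4 * beta <= t (S j) - t j) ->
     (forall j, (1 <= j <= N)%nat -> 2 * beta <= t j < Tmax) ->
     Gt g ->
     let Q := threshold rho a M L K sigma beta (norm g) in
     let F := F_meas Tadj m beta g in
     exists tt ff : nat -> R,
       burst_outputs rho beta Q Tmax F N t tt ff /\
       forall j, (1 <= j <= N)%nat ->
         (detected rho beta Q F (t j) = true -> Rabs (tt j - t j) <= beta) /\
         Rabs (ff j - ip (h j) g) <=
           shape_error_bound ip T rho a M L K sigma beta Q (t j) (h j) g)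
  /\
  (0 < sigma ->
   forall g : H, Gt g ->
   exists beta0 : R, 0 < beta0 /\
     forall beta Tmax : R,
       0 < beta < beta0 ->
       (forall j, (1 <= j <= N)%nat -> t j < Tmax) ->
       let Q := threshold rho a M L K sigma beta (norm g) in
       let F := F_meas Tadj m beta g in
       exists tt ff : nat -> R,
         burst_outputs rho beta Q Tmax F N t tt ff /\
         forall j, (1 <= j <= N)%nat ->
           (detected rho beta Q F (t j) = true -> Rabs (tt j - t j) <= beta) /\
           Rabs (ff j - ip (h j) g) <=
             shape_error_bound ip T rho a M L K sigma beta Q (t j) (h j) g /\
           Rabs (ff j - ip (h j) g) <= 13 * sigma).
Proof.
  set (A0 := Rmax a 0).
  assert (HA0 : forall beta, 0 <= M * exp (A0 * beta))
    by (intros beta; apply Rmult_le_pos; [lra | left; apply exp_pos]).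
  split.
  - intros Ha beta Tmax g Hb Hsep Htm _ Q F.
    (* For nonnegative [a] the two semigroup bounds coincide, so the excess to be absorbed is
       zero. *)
    assert (Hslack : forall p, 0 <= p ->
      let c := exp (p * rho * beta) in
      (M * exp (A0 * beta) - M * exp (a * beta))
        * (p * c * L * beta + (c - 1) * K) * norm g <= 2 * (c - 1) * sigma).
    { intros p Hp c. unfold A0. rewrite Rmax_left by trivial.
      assert (0 <= sigma)
        by (eapply Rle_trans; [apply Rabs_pos | apply (Hnu 0 g); lra]).
      assert (0 <= c - 1).
      { pose proof (exp_ineq1_le (p * rho * beta)).
        assert (0 <= p * rho * beta) by (repeat apply Rmult_le_pos; lra).
        unfold c; lra. }
      rewrite Rminus_diag, !Rmult_0_l. nra. }
    apply (algorithm_accuracy ip Hip T Tadj HT HTadj M a HM HMa u0 rho Hrho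
      N t h eta K L HK HL HetaK HetaL u Hu nu m sigma Hnu Hm beta Tmax g Hb
      Hsep Htm (M * exp (A0 * beta)) (HA0 beta)).
    + intros s x Hs. now apply (semigroup_bound T M a HM HMa).
    + pose proof (noise_slack _ _ _ _ _ _ _ _ _ 1 (Hslack 1 ltac:(lra))) as HQ.
      rewrite !Rmult_1_l in HQ. exact HQ.
    + apply (noise_slack _ _ _ _ _ _ _ _ _ 3 (Hslack 3 ltac:(lra))).
  - intros Hsigma g _.
    pose proof (norm_ge_0 g) as Hg0.
    (* Keeps [norm g * eps] at most [sigma / 2]; the added 1 covers [norm g = 0]. *)
    pose (eps := sigma / (2 * (norm g + 1))).
    assert (Heps : 0 < eps) by (apply Rdiv_lt_0_compat; lra).
    assert (Hgeps : norm g * eps <= sigma / 2).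
    { unfold eps. replace (norm g * (sigma / (2 * (norm g + 1))))
        with (sigma / 2 * (norm g / (norm g + 1))) by (field; lra).
      rewrite <- (Rmult_1_r (sigma / 2)) at 2.
      apply Rmult_le_compat_l; [lra|].
      apply Rmult_le_reg_r with (norm g + 1); [lra|].
      unfold Rdiv. rewrite Rmult_assoc, Rinv_l by lra. lra. }
    pose (vb := fun (j : nat) beta =>
      norm g * (M * exp (A0 * beta) * norm (h j) * (exp (3 * rho * beta) - 1)
                + eps)).
    pose (S3 := fun beta => 3 * exp ((3 * rho + a) * beta) * M * L * norm g * beta
      + exp (a * beta) * (exp (3 * rho * beta) - 1) * M * K * norm g
      + 4 * exp (3 * rho * beta) * sigma).
    assert (Hev : at_right 0 (fun beta =>
      (((forall j, (1 <= j <= N)%nat -> (j < N)%nat -> 4 * beta < t (S j) - t j) /\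
        (forall j, (1 <= j <= N)%nat -> 2 * beta < t j)) /\
       ((M * exp (A0 * beta) - M * exp (a * beta))
          * (exp (3 * rho * beta) * L / rho + K) * norm g < 2 * sigma)) /\
      ((forall j, (1 <= j <= N)%nat ->
          S3 beta + 2 * exp (rho * beta)
            * threshold rho a M L K sigma beta (norm g) + vb j beta
          < 13 * sigma) /\
       (forall j, (1 <= j <= N)%nat -> forall s, 0 <= s <= beta ->
          norm (minus (T s (h j)) (h j)) <= eps)))).
    { destruct Ht as [Ht0 Ht1].
      repeat apply filter_and.
      - apply filter_forall_range; [typeclasses eauto|]. intros j Hj.
        destruct (Nat.lt_ge_cases j N) as [Hlt | Hge].
        + apply filter_imp with (fun beta => 4 * beta < t (S j) - t j); [trivial|].
          apply at_right_continuous_lt; [auto_derive; trivial|].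
          specialize (Ht1 j ltac:(lia)). lra.
        + apply filter_forall. intros beta Hlt. lia.
      - apply filter_forall_range; [typeclasses eauto|]. intros j Hj.
        apply at_right_continuous_lt; [auto_derive; trivial|].
        specialize (Ht0 j Hj). lra.
      - apply (at_right_continuous_lt (fun beta =>
          (M * exp (A0 * beta) - M * exp (a * beta))
          * (exp (3 * rho * beta) * L / rho + K) * norm g)).
        + auto_derive; trivial.
        + rewrite !Rmult_0_r, !exp_0. lra.
      - apply filter_forall_range; [typeclasses eauto|]. intros j Hj.
        apply (at_right_continuous_lt (fun beta =>
          S3 beta + 2 * exp (rho * beta)
            * threshold rho a M L K sigma beta (norm g) + vb j beta));
          unfold S3, threshold, vb.
        + auto_derive; trivial.
        (* At [beta = 0] the terms are [4 * sigma], [2 * (4 * sigma)] and at most [sigma / 2], in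
           total below [13 * sigma]. *)
        + rewrite !Rmult_0_r, !exp_0. lra.
      - apply filter_forall_range; [typeclasses eauto|]. intros j Hj.
        destruct (semigroup_right_continuous T HT (h j) eps Heps) as [d [Hd Hs]].
        exists (mkposreal d Hd). intros beta Hbd Hb s Hsb.
        change (Rabs (beta - 0) < d) in Hbd.
        rewrite Rabs_pos_eq in Hbd by lra. left. apply Hs. lra. }
    destruct Hev as [b0 Hev].
    exists b0. split; [apply cond_pos|]. intros beta Tmax Hb HTm Q F.
    destruct (Hev beta) as [[[Hsep Htj] Hexc] [Hbound Hsmall]]; [|lra|].
    { change (Rabs (beta - 0) < b0). rewrite Rabs_pos_eq; lra. }
    assert (Hlow : M * exp (a * beta) <= M * exp (A0 * beta)).
    { apply Rmult_le_compat_l; [lra|]. apply exp_monotone.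
      pose proof (Rmax_l a 0). unfold A0. nra. }
    assert (Hslack : forall p, 1 <= p <= 3 ->
      let c := exp (p * rho * beta) in
      (M * exp (A0 * beta) - M * exp (a * beta))
        * (p * c * L * beta + (c - 1) * K) * norm g <= 2 * (c - 1) * sigma).
    { intros p Hp. apply noise_slack_small_step; trivial; lra. }
    destruct (algorithm_accuracy ip Hip T Tadj HT HTadj M a HM HMa u0 rho Hrho
      N t h eta K L HK HL HetaK HetaL u Hu nu m sigma Hnu Hm beta Tmax g
      (proj1 Hb)) with (C := M * exp (A0 * beta)) (Q := Q) (B := S3 beta)
      as [tt [ff [Hout Hacc]]].
    + intros j Hj. left. apply Hsep; lia.
    + intros j Hj. specialize (HTm j Hj). specialize (Htj j Hj). lra.
    + apply HA0.
    + intros s x Hs. now apply (semigroup_bound T M a HM HMa).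
    + pose proof (noise_slack _ _ _ _ _ _ _ _ _ 1 (Hslack 1 ltac:(lra))) as HQ.
      rewrite !Rmult_1_l in HQ. exact HQ.
    + apply (noise_slack _ _ _ _ _ _ _ _ _ 3 (Hslack 3 ltac:(lra))).
    + exists tt, ff. split; [exact Hout|]. intros j Hj.
      destruct (Hacc j Hj) as [Htime Hshape].
      split; [exact Htime|]. split; [exact Hshape|].
      eapply Rle_trans; [exact Hshape|].
      assert (Hv : forall k, (k <= 1)%nat ->
                v ip T rho beta k (t j) (h j) g <= vb j beta).
      { intros k Hk. specialize (Htj j Hj).
        apply (v_bound ip Hip T HT M a HM HMa rho Hrho); trivial; try lra.
        - intros s x Hs. now apply (semigroup_bound T M a HM HMa).
        - now apply Hsmall. }
      assert (Hmax : Rmax (v ip T rho beta 0 (t j) (h j) g)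
                          (v ip T rho beta 1 (t j) (h j) g) <= vb j beta)
        by (apply Rmax_lub; apply Hv; lia).
      specialize (Hbound j Hj). fold Q in Hbound. lra.
Qed.
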